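(* Let $B$ be a balanced configuration of seven non-zero vectors in $\mathbb{R}^2$. Then $B$ is $GL(2,\mathbb{R})$-equivalent to one of the following: i) a regular heptagon; ii) a configuration $B_1\cup B_2$ (disjoint union, as multisets), where $B_2$ is a regular pentagon and $B_1=\{\lambda c,-\lambda c\}$ with $c\in B_2$ and $\lambda\in\mathbb{R}\setminus\{0\}$; iii) the configuration $\{e_1,\ e_2,\ -e_1-e_2,\ \lambda e_1,\ -\lambda e_1,\ \mu e_2,\ -\mu e_2\}$, where $\lambda,\mu$ are non-zero real scalars; iv) the configuration $\{e_1,\ e_2,\ -e_1-e_2,\ \lambda e_1,\ -\lambda e_1,\ \mu e_1,\ -\mu e_1\}$, where $\lambda,\mu$ are non-zero real scalars; v) a configuration of seven vectors in one line (through the origin).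
   Context: A configuration $B=\{b_1,\dots,b_n\}\subset\mathbb{R}^2$ is a finite indexed family of vectors (repetitions allowed). $B$ is balanced if for every index $j$ the multiset $\{\det(b_j,b_i): i\neq j\}$ is symmetric around the origin, i.e. invariant, with multiplicities, under multiplication by $-1$. (Equivalently, for non-zero vectors, all cocircuits of $B$ are balanced, where a cocircuit is the subfamily $B(J)$ of all vectors of $B$ on a given line through the origin, and it is balanced if for $j\in J$ the multiset $\{\det(b_i,b_j): i\notin J\}$ is symmetric around the origin.) Two configurations are $GL(2,\mathbb{R})$-equivalent if some $g\in GL(2,\mathbb{R})$ carries one to the other up to reordering. A regular $k$-gon is the configuration of the $k$ vertices of a regular $k$-gon centered at the origin. $e_1,e_2$ is the standard basis of $\mathbb{R}^2$. *)

(* Defs.v *)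
From mathcomp Require Import all_boot all_order all_algebra.
From mathcomp Require Import reals trigo.

Set Implicit Arguments.
Unset Strict Implicit.
Unset Printing Implicit Defensive.

Import Order.TTheory GRing.Theory Num.Theory.
Local Open Scope ring_scope.

Definition e1 (R : realType) : 'cV[R]_2 := delta_mx 0 0.
Definition e2 (R : realType) : 'cV[R]_2 := delta_mx 1 0.

Definition det2 (R : realType) (u v : 'cV[R]_2) : R :=
  \det (row_mx u v : 'M[R]_2).

Definition det_family (R : realType) (n : nat) (B : n.-tuple 'cV[R]_2)
    (j : 'I_n) : seq R :=
  [seq det2 (tnth B j) (tnth B i) | i <- enum 'I_n & i != j].

Definition balanced (R : realType) (n : nat) (B : n.-tuple 'cV[R]_2) : Prop :=
  forall j : 'I_n,
    perm_eq (det_family B j) [seq - x | x <- det_family B j].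

Definition GL2_equiv (R : realType) (B C : seq 'cV[R]_2) : Prop :=
  exists2 g : 'M[R]_2, g \in unitmx & perm_eq [seq g *m b | b <- B] C.

Definition polar (R : realType) (r t : R) : 'cV[R]_2 :=
  (r * cos t) *: e1 R + (r * sin t) *: e2 R.

(* The circumradius r and the phase t are arbitrary, and perm_eq makes the
   notion independent of the order in which the vertices are listed. *)
Definition regular_polygon (R : realType) (k : nat) (P : k.-tuple 'cV[R]_2) :
    Prop :=
  exists r t : R, 0 < r /\
    perm_eq P [seq polar r (t + 2 * pi * j%:R / k%:R) | j <- iota 0 k].

Definition on_line_through_0 (R : realType) (C : seq 'cV[R]_2) : Prop :=
  exists2 d : 'cV[R]_2, d != 0 &
    forall v : 'cV[R]_2, v \in C -> exists a : R, v = a *: d.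

(* Main.v *)
Require Import Defs.
From mathcomp Require Import all_boot all_order all_algebra.
From mathcomp Require Import reals trigo.
From mathcomp Require Import ring lra zify.

Set Implicit Arguments.
Unset Strict Implicit.
Unset Printing Implicit Defensive.

Import Order.TTheory GRing.Theory Num.Theory.
Local Open Scope ring_scope.

(** The proof works with the list of the seven vectors and separates cases by
    the sizes of the lines through the origin that carry them.  The non-zero
    determinants against a given vector come in opposite pairs, so an even
    number of vectors lies off each of these lines, and all line sizes are odd:
    7, 5+1+1, 3+3+1, 3+1+1+1+1 or 1+1+1+1+1+1+1.  The first shape is a
    line, and the next two are settled by cancelling opposite entries in
    symmetric multisets.
    In the shape 3+1+1+1+1, two of the three collinear vectors are opposite
    ([three_collinear_opposite]); removing them leaves five balanced vectors on
    five different lines.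

    There remains the uniform case, where no two vectors are parallel: a uniform
    balanced configuration of [n] vectors, with [n] odd and at least 5, is a
    regular polygon up to a linear map ([uniform_balanced_regular]).  The engine
    is [net_identity]: as polynomials in the coordinates of [x] and in [T],

      [\prod_b (T + det x b) - \prod_b (T - det x b) = 2 \prod_b det x b].

    For [x] on the line of some [b] it holds by symmetry; the difference of the
    two sides has degree less than [n] in [x] and vanishes on [n] lines.  In the
    projective plane this is a pencil containing three products of [n] lines, a
    3-net.  Two consequences are used: [b + b'] is always parallel to some
    configuration vector ([net_parallel]), and the numbers [det u b] are
    pairwise distinct for [u] in the configuration ([net_latin]).

    Balancedness also forces the vectors, sorted by slope, to lie alternately on
    both sides of a line.  With signs changed accordingly they form a sequence
    [c] that turns monotonically and satisfies [c (k + n) = - c k]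
    ([cyclic_order]).  For [i] and [j] of equal parity, [c i + c j] then has to be
    parallel to some [c k] with [i < k < j].  For [j = i + 2] this says that all
    [det (c i) (c i.+1)] agree; for [j = i + 4], together with [net_latin], that
    all [det (c i) (c i.+2)] agree.  Hence [c i + c i.+2 = a c i.+1] for a constant
    [a], and monotone turning leaves only [a = 2 cos (pi / n)]
    ([recurrence_circle]).  The configuration consists of the [c (2 * j)]. *)

(** * The determinant of two plane vectors *)

Section Det2.
Context (R : realType).
Implicit Types (u v w x : 'cV[R]_2) (a b : R).

Lemma det2E u v : det2 u v = u 0 0 * v 1 0 - u 1 0 * v 0 0.
Proof.
have E0 i : row_mx u v i 0 = u i 0.
  by rewrite -(row_mxEl u v); congr (row_mx _ _ i _); apply: val_inj.
have E1 i : row_mx u v i 1 = v i 0.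
  by rewrite -(row_mxEr u v); congr (row_mx _ _ i _); apply: val_inj.
have detE (M : 'M[R]_2) : \det M = M 0 0 * M 1 1 - M 1 0 * M 0 1.
  rewrite (expand_det_row _ 0) big_ord_recl big_ord1 /cofactor !det_mx11 !mxE.
  rewrite (_ : lift 0 0 = 1 :> 'I_2); last exact: val_inj.
  rewrite (_ : lift 1 0 = 0 :> 'I_2); last exact: val_inj.
  rewrite (_ : 0%N + 1%N = 1)%N // expr0 expr1 mul1r mulN1r mulrN.
  by rewrite [M 1 0 * _]mulrC.
by rewrite /det2 detE !(E0, E1).
Qed.

Lemma eq_col2 u v : u 0 0 = v 0 0 -> u 1 0 = v 1 0 -> u = v.
Proof.
move=> h0 h1; apply/matrixP => i j; rewrite ord1.
by case: i => [[|[|//]] hi]; [rewrite (_ : Ordinal hi = 0)|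
  rewrite (_ : Ordinal hi = 1)] => //; apply: val_inj.
Qed.

Lemma col2_eq0 u : (u == 0) = (u 0 0 == 0) && (u 1 0 == 0).
Proof.
apply/eqP/andP => [->|[/eqP h0 /eqP h1]]; first by rewrite !mxE eqxx.
by apply: eq_col2; rewrite ?h0 ?h1 mxE.
Qed.

Lemma det2_antisym u v : det2 u v = - det2 v u.
Proof. by rewrite !det2E; ring. Qed.

Lemma det2vv u : det2 u u = 0.
Proof. by rewrite !det2E; ring. Qed.

Lemma det2Dl u v w : det2 (u + v) w = det2 u w + det2 v w.
Proof. by rewrite !det2E !mxE; ring. Qed.

Lemma det2Dr u v w : det2 w (u + v) = det2 w u + det2 w v.
Proof. by rewrite !det2E !mxE; ring. Qed.

Lemma det2Zl a u v : det2 (a *: u) v = a * det2 u v.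
Proof. by rewrite !det2E !mxE; ring. Qed.

Lemma det2Zr a u v : det2 u (a *: v) = a * det2 u v.
Proof. by rewrite !det2E !mxE; ring. Qed.

Lemma det2Nl u v : det2 (- u) v = - det2 u v.
Proof. by rewrite -scaleN1r det2Zl mulN1r. Qed.

Lemma det2Nr u v : det2 u (- v) = - det2 u v.
Proof. by rewrite -scaleN1r det2Zr mulN1r. Qed.

(** The Grassmann-Pluecker relation. *)
Lemma det2_plucker u v w x :
  det2 u v * det2 w x - det2 u w * det2 v x + det2 u x * det2 v w = 0.
Proof. by rewrite !det2E; ring. Qed.

Lemma det2_cramer u v w : det2 u v *: w = det2 w v *: u + det2 u w *: v.
Proof. by apply: eq_col2; rewrite !det2E !mxE; ring. Qed.

Lemma det2_neq0l u v : det2 u v != 0 -> u != 0.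
Proof. by apply: contraNneq => ->; rewrite det2E !mxE !mul0r subrr. Qed.

Lemma det2_neq0_sym u v : (det2 u v != 0) = (det2 v u != 0).
Proof. by rewrite det2_antisym oppr_eq0. Qed.

Lemma det2_eq0_sym u v : (det2 u v == 0) = (det2 v u == 0).
Proof. by rewrite det2_antisym oppr_eq0. Qed.

Lemma parallelP u v : u != 0 -> reflect (exists a, v = a *: u) (det2 u v == 0).
Proof.
move=> u0; apply: (iffP eqP) => [|[a ->]]; last by rewrite det2Zr det2vv mulr0.
rewrite det2E => h; move: u0; rewrite col2_eq0 negb_and => /orP[] h0.
  exists (v 0 0 / u 0 0); apply: eq_col2; rewrite !mxE ?divfK //.
  by apply: (mulfI h0); rewrite mulrA mulrCA divff // mulr1 mulrC; lra.
exists (v 1 0 / u 1 0); apply: eq_col2; rewrite !mxE ?divfK //.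
by apply: (mulfI h0); rewrite mulrA mulrCA divff // mulr1 mulrC; lra.
Qed.

Lemma det2_eq0_trans u v w :
  v != 0 -> det2 u v = 0 -> det2 v w = 0 -> det2 u w = 0.
Proof.
move=> v0 /eqP; rewrite det2_eq0_sym => /(parallelP _ v0)[a ->].
by move=> /eqP/(parallelP _ v0)[b ->]; rewrite det2Zl det2Zr det2vv !mulr0.
Qed.

Lemma exists_gl2 p q p' q' : det2 p q != 0 -> det2 p' q' != 0 ->
  exists2 g : 'M[R]_2, g \in unitmx & g *m p = p' /\ g *m q = q'.
Proof.
move=> h h'; have hu : (row_mx p q : 'M[R]_2) \in unitmx by rewrite unitmxE unitfE.
exists ((row_mx p' q' : 'M[R]_2) *m invmx (row_mx p q : 'M[R]_2)).
  by rewrite unitmx_mul unitmx_inv hu unitmxE unitfE h'.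
suff E : row_mx (row_mx p' q' *m invmx (row_mx p q : 'M[R]_2) *m p)
            (row_mx p' q' *m invmx (row_mx p q : 'M[R]_2) *m q) = row_mx p' q'.
  by have [-> ->] := eq_row_mx E.
by rewrite -mul_mx_row -mulmxA mulVmx // mulmx1.
Qed.

(** Only finitely many directions are excluded by a finite list. *)
Lemma exists_generic (s : seq 'cV[R]_2) : {in s, forall v, v != 0} ->
  exists y, {in s, forall v, det2 y v != 0}.
Proof.
move=> s0; pose t := 1 + \sum_(v <- s) `|v 1 0 / v 0 0|.
have t_gt v : v \in s -> v 1 0 / v 0 0 < t.
  move=> vs; rewrite /t (perm_big _ (perm_to_rem vs)) big_cons /=.
  have : 0 <= \sum_(w <- rem v s) `|w 1 0 / w 0 0| by rewrite sumr_ge0.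
  by have := ler_norm (v 1 0 / v 0 0); lra.
exists (e1 R + t *: e2 R) => v vs; rewrite det2E !mxE /=.
rewrite mulr0 addr0 mul1r mulr1 add0r.
have [v0|v0] := eqVneq (v 0 0) 0.
  by rewrite v0 mulr0 subr0; move: (s0 v vs); rewrite col2_eq0 v0 eqxx.
rewrite subr_eq0; apply/negP => /eqP h; have := t_gt v vs.
by rewrite h mulfK // ltxx.
Qed.

End Det2.

(** * Multisets of reals that are symmetric around the origin *)

Section Symmetric.
Context (R : realType).
Implicit Types (l : seq R) (a x y : R).

Definition symm l := perm_eq l [seq - x | x <- l].

Lemma perm_symm l1 l2 : perm_eq l1 l2 -> symm l1 = symm l2.
Proof.
move=> h; rewrite /symm (permPl h).
by have /permPr -> := perm_map (fun x => - x) h.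
Qed.

Lemma symm_count l x : symm l -> count_mem x l = count_mem (- x) l.
Proof.
move=> /permP ->; rewrite count_map; apply: eq_count => y /=.
by rewrite eqr_oppLR.
Qed.

Lemma symm_mem l x : symm l -> x \in l -> - x \in l.
Proof. by move=> h; rewrite -!has_pred1 !has_count (symm_count x h). Qed.

Lemma symm_odd_sum l (f : R -> R) : (forall x, f (- x) = - f x) ->
  symm l -> \sum_(x <- l) f x = 0.
Proof.
move=> fN h; have : \sum_(x <- l) f x = - \sum_(x <- l) f x.
  rewrite {1}(perm_big _ h) big_map -sumrN; apply: eq_bigr => x _; exact: fN.
by move=> H; lra.
Qed.

Lemma symm_sum l : symm l -> \sum_(x <- l) x = 0.
Proof. exact: symm_odd_sum. Qed.

Lemma symm_scale a l : a != 0 -> symm [seq a * x | x <- l] = symm l.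
Proof.
move=> a0; rewrite /symm.
have -> : [seq - y | y <- [seq a * x | x <- l]] = [seq a * y | y <- [seq - x | x <- l]].
  by rewrite -!map_comp; apply: eq_map => x /=; rewrite mulrN.
by apply/idP/idP => [/(perm_map_inj (mulfI a0))|/(perm_map ( *%R a))].
Qed.

Lemma symm_pair a l : symm (a :: - a :: l) = symm l.
Proof.
have h l1 : perm_eq [:: - a, a & l1] [:: a, - a & l1].
  by apply/permP => p /=; rewrite addnCA.
by rewrite /symm /= opprK (permPr (h _)) -(perm_cat2l [:: a; - a]).
Qed.

Lemma symm_cons0 l : symm (0 :: l) = symm l.
Proof. by rewrite /symm /= oppr0 perm_cons. Qed.

Lemma symm_cat0 l1 l2 : all (pred1 0) l1 -> symm (l1 ++ l2) = symm l2.
Proof.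
by elim: l1 => //= x l1 IH /andP[/eqP -> /IH <-]; rewrite symm_cons0.
Qed.

Lemma symm_cons a l : a != 0 -> symm (a :: l) ->
  exists2 l', perm_eq l (- a :: l') & symm l'.
Proof.
move=> a0 h; have : - a \in l.
  have := symm_mem h (mem_head a l); rewrite inE => /predU1P[/eqP|//].
  by rewrite -subr_eq0 => /eqP Na; move: a0; rewrite (_ : a = 0) ?eqxx //; lra.
move=> /perm_to_rem hl; exists (rem (- a) l) => //.
by rewrite -(symm_pair a) -(perm_symm (l1 := a :: l)) // perm_cons.
Qed.

(** There are as many positive as negative entries. *)
Lemma symm_even_nonzero l : symm l -> ~~ odd (count (fun x => x != 0) l).
Proof.
move=> h; rewrite (eq_count (_ : _ =1 predU (fun x => 0 < x) (fun x => x < 0))).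
  rewrite -(addn0 (count _ l)) -(count_pred0 l).
  rewrite -(eq_count (_ : predI (fun x => 0 < x) (fun x => x < 0) =1 pred0)).
    rewrite count_predUI [X in (X + _)%N](permP h).
    by rewrite count_map (eq_count (fun x => oppr_gt0 x)) addnn odd_double.
  by move=> x /=; apply/negbTE; rewrite negb_and -!leNgt; case: ltgtP.
by move=> x /=; rewrite neq_lt orbC.
Qed.

Lemma symm_even_size l : all (fun x => x != 0) l -> symm l -> ~~ odd (size l).
Proof. by move=> h /symm_even_nonzero; rewrite (eqP (etrans (esym (all_count _ _)) h)). Qed.

(** The opposites of the entries of [l1] must be found in [l2], which has no
    room for anything else. *)
Lemma symm_halves l1 l2 : symm (l1 ++ l2) -> size l1 = size l2 ->
  (forall x y, x \in l1 -> y \in l1 -> x + y != 0) ->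
  perm_eq l2 [seq - x | x <- l1].
Proof.
elim: l1 l2 => [|a l1 IH] l2 h sz no_opp; first by case: l2 sz {h}.
have a0 : a != 0.
  by apply: contraNneq (no_opp a a (mem_head _ _) (mem_head _ _)) => ->; rewrite addr0.
have [l' hp hl'] := symm_cons a0 h.
have Na1 : - a \notin l1.
  apply/negP => Na; have := no_opp a (- a) (mem_head _ _).
  by rewrite inE Na orbT subrr eqxx => /(_ isT).
have Na2 : - a \in l2.
  have : - a \in l1 ++ l2 by rewrite (perm_mem hp) mem_head.
  by rewrite mem_cat (negbTE Na1).
have hp2 := perm_to_rem Na2.
rewrite (permPl hp2) /= perm_cons; apply: IH.
- move: h; rewrite -(symm_pair a (l1 ++ _)) (perm_symm (l2 := [:: a, - a & l1 ++ rem (- a) l2])) //.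
  by rewrite perm_cons; apply/permP => p; rewrite /= !count_cat (permP hp2) /= addnCA.
- by move: sz; rewrite (perm_size hp2) => -[].
- by move=> x y hx hy; apply: no_opp; rewrite inE ?hx ?hy orbT.
Qed.

End Symmetric.

(** * Products of affine functions *)

Section AffineProducts.
Context (R : realType) (T : eqType).
Implicit Types (s : seq T) (f g : T -> R).

(** The indeterminate is the parameter of a line [x + t *: y] in the plane, and
    [f], [g] collect the determinants with [x] and with [y]. *)
Definition affprod s f g : {poly R} := \prod_(v <- s) (g v *: 'X + (f v)%:P).

Lemma horner_affprod s f g t :
  (affprod s f g).[t] = \prod_(v <- s) (f v + g v * t).
Proof.
rewrite /affprod horner_prod; apply: eq_bigr => v _.
by rewrite !hornerE addrC.
Qed.

Lemma affprod_cons v s f g :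
  affprod (v :: s) f g = (g v *: 'X + (f v)%:P) * affprod s f g.
Proof. by rewrite /affprod big_cons. Qed.

Lemma perm_affprod s s' f g : perm_eq s s' -> affprod s f g = affprod s' f g.
Proof. exact: perm_big. Qed.

Lemma affprod_size_coef s f g : (size (affprod s f g) <= (size s).+1)%N /\
  (affprod s f g)`_(size s) = \prod_(v <- s) g v.
Proof.
elim: s => [|v s [IHs IHc]].
  by rewrite /affprod !big_nil size_poly1 coef1 eqxx.
rewrite affprod_cons big_cons -IHc mulrDl -scalerAl; split.
  rewrite (leq_trans (size_polyD _ _)) // geq_max.
  apply/andP; split.
    rewrite (leq_trans (size_scale_leq _ _)) // (leq_trans (size_polyMleq _ _)) //.
    rewrite size_polyX; exact: IHs.
  rewrite (leq_trans (size_polyMleq _ _)) // size_polyC.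
  move: IHs => /=; case: (f v != 0) => /=; lia.
rewrite coefD coefZ coefXM /= coefCM [X in _ + f v * X]nth_default ?mulr0 ?addr0 //.
Qed.

(** Two factors vanishing at the origin produce a double root there. *)
Lemma affprod_double_root s f g :
  (1 < count (fun v => f v == 0%R) s)%N -> (affprod s f g)`_1 = 0.
Proof.
pose p v := f v == 0 => hp; rewrite (perm_affprod (s' := filter p s ++ filter (predC p) s)).
  have : all p (filter p s) by exact: filter_all.
  move: hp; rewrite -size_filter; case: (filter p s) => [|v [|w l]] //= _ /and3P[].
  move=> /eqP fv /eqP fw _; rewrite !affprod_cons fv fw !addr0.
  by rewrite -!scalerAl coefZ coefXM /= coefZ coefXM !mulr0.
by rewrite perm_sym; apply/permPl/perm_filterC.
Qed.

Lemma affprod_simple_root v s f g : f v = 0 ->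
  (affprod (v :: s) f g)`_1 = g v * \prod_(w <- s) f w.
Proof.
move=> fv; rewrite affprod_cons fv addr0 -scalerAl coefZ coefXM /=.
congr (_ * _); rewrite -horner_coef0 horner_affprod.
by apply: eq_bigr => w _; rewrite mulr0 addr0.
Qed.

End AffineProducts.

(** * Uniform balanced configurations of odd size *)

Section Uniform.
Context (R : realType).
Implicit Types (s : seq 'cV[R]_2) (u v w x y : 'cV[R]_2).

(** Unlike in [balanced], the vanishing determinant of a vector with itself is
    counted; this does not affect symmetry, and it makes the notion visibly
    independent of the order of the list. *)
Definition balanced_seq s := {in s, forall u, symm [seq det2 u v | v <- s]}.

(** Each entry is parallel to itself, so the bound says that no other entry lies
    on its line. *)
Definition uniform s :=
  {in s, forall u, (count (fun v => det2 u v == 0%R) s <= 1)%N}.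

Lemma perm_balanced_seq s s' : perm_eq s s' -> balanced_seq s -> balanced_seq s'.
Proof.
move=> h b u; rewrite -(perm_mem h) => /b; apply: etrans; apply: perm_symm.
by rewrite perm_sym perm_map.
Qed.

Lemma perm_uniform s s' : perm_eq s s' -> uniform s -> uniform s'.
Proof. by move=> h b u; rewrite -(perm_mem h) => /b; rewrite (permP h). Qed.

(** Along the line [x + t *: y] each side is a polynomial in [t] of degree at
    most [size s]; the leading coefficients agree because [size s] is odd. For
    every [v \in s] some parameter puts [x + t *: y] on the line of [v]: there
    the two products on the left agree by balancedness and the one on the right
    vanishes.  These are [size s] distinct parameters, too many for a nonzero
    difference. *)
Lemma net_identity s x y (T : R) :
  odd (size s) -> balanced_seq s -> uniform s -> det2 x y != 0 ->
  {in s, forall v, det2 y v != 0} ->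
  affprod s (fun v => T + det2 x v) (det2 y) -
    affprod s (fun v => T - det2 x v) (fun v => - det2 y v) =
  2 *: affprod s (det2 x) (det2 y).
Proof.
move=> odd_s bs us xy ys; apply/eqP; rewrite -subr_eq0.
set H := _ - _ - _; apply: contraTT isT => H0; exfalso.
have y0 : y != 0 by move: xy; rewrite det2_neq0_sym; exact: det2_neq0l.
have s0 v : v \in s -> v != 0.
  by move=> /ys; rewrite det2_neq0_sym; exact: det2_neq0l.
have sizeH : (size H <= size s)%N.
  apply/leq_sizeP => j; rewrite leq_eqVlt => /predU1P[<-|lt_j].
    (* The leading coefficients cancel: (-1) ^+ size s = -1. *)
    rewrite /H !coefB coefZ !(affprod_size_coef _ _ _).2.
    rewrite [X in _ - X - _](eq_bigr (fun v => -1 * det2 y v)); last by move=> v _; rewrite mulN1r.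
    rewrite big_split /= big_const_seq count_predT.
    rewrite (_ : iter _ _ _ = -1); first by ring.
    by rewrite iter_mulr_1 -signr_odd odd_s.
  by rewrite /H !coefB coefZ !nth_default ?mulr0 ?subrr //;
    apply: leq_trans lt_j; exact: (affprod_size_coef _ _ _).1.
(* The parameter for which x + t *: y lies on the line of v. *)
pose t v := - det2 x v / det2 y v.
have on_line v : v \in s -> exists a, x + t v *: y = a *: v.
  move=> vs; apply/parallelP; first exact: s0.
  rewrite det2_eq0_sym det2Dl det2Zl /t divfK ?addrN //; exact: ys.
have ut : uniq (map t s).
  apply: count_mem_uniq => r.
  have [/mapP[v vs ->]|r_notin] := boolP (r \in map t s); last first.
    by apply/count_memPn.
  apply/eqP; rewrite eqn_leq -has_count has_pred1 map_f // andbT.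
  rewrite count_map (leq_trans _ (us v vs)) //.
  rewrite -!size_filter; apply: size_subseq.
  have -> : filter (preim t (pred1 (t v))) s =
     filter (preim t (pred1 (t v))) (filter (fun w => det2 v w == 0) s).
    rewrite -filter_predI; apply: eq_in_filter => w ws /=.
    apply/idP/andP => [/eqP e|[]//]; split; first exact/eqP.
    have [a ha] := on_line v vs; have [b hb] := on_line w ws.
    have z0 : x + t v *: y != 0.
      apply: contraNneq xy => /(congr1 (fun z => det2 z y)).
      by rewrite det2Dl det2Zl det2vv mulr0 addr0 => ->; rewrite det2E !mxE !mul0r subrr.
    apply/eqP; apply: (det2_eq0_trans z0); first by rewrite ha det2Zr det2vv mulr0.
    by rewrite -e hb det2Zl det2vv mulr0.
  exact: filter_subseq.
suff /(max_poly_roots H0)/(_ ut) : all (root H) (map t s).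
  by rewrite size_map ltnNge sizeH.
apply/allP => r /mapP[v vs ->]; rewrite /root /H !hornerE !horner_affprod.
have [a ha] := on_line v vs.
have E w : det2 x w + det2 y w * t v = a * det2 v w.
  by rewrite -det2Zl -ha det2Dl det2Zl mulrC.
rewrite (eq_bigr (fun w => T + a * det2 v w)); last by move=> w _; rewrite -E addrA.
rewrite [X in _ - X - _](eq_bigr (fun w => T - a * det2 v w)); last first.
  by move=> w _; rewrite -E mulNr opprD addrA.
rewrite [X in _ - _ * X](eq_bigr (fun w => a * det2 v w)); last by move=> w _; rewrite E.
rewrite [X in _ - _ * X](perm_big _ (perm_to_rem vs)) big_cons.
rewrite /= det2vv mulr0 mul0r mulr0.
rewrite subr0 subr_eq0; apply/eqP.
rewrite -(big_map (det2 v) xpredT (fun z => T + a * z)).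
rewrite (perm_big _ (bs v vs)) !big_map.
by apply: eq_bigr => w _; rewrite mulrN.
Qed.

(** With [T := det2 x b] and [x := b + b'] both products on the left of
    [net_identity] vanish at [x], hence so does the right-hand side. *)
Lemma net_parallel s b b' :
  odd (size s) -> balanced_seq s -> uniform s -> {in s, forall v, v != 0} ->
  b \in s -> b' \in s -> det2 b b' != 0 ->
  exists2 v, v \in s & det2 v (b + b') = 0.
Proof.
move=> odd_s bs us s0 hb hb' bb'; pose x := b + b'.
have x0 : x != 0.
  apply: contraNneq bb' => /(congr1 (det2 b)); rewrite det2Dr det2vv add0r => ->.
  by rewrite det2E !mxE !mulr0 subrr.
have [|y hy] := @exists_generic _ (x :: s).
  by move=> v; rewrite inE => /predU1P[->|/s0].
have xy : det2 x y != 0 by rewrite det2_neq0_sym hy ?mem_head.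
have ys : {in s, forall v, det2 y v != 0} by move=> v vs; rewrite hy // inE vs orbT.
have := net_identity (det2 x b) odd_s bs us xy ys.
move=> /(congr1 (fun p => p.[0])); rewrite !hornerE !horner_affprod.
have xb' : det2 x b' = - det2 x b.
  by rewrite !det2Dl !det2vv addr0 add0r det2_antisym.
rewrite [X in X - _](perm_big _ (perm_to_rem hb')) big_cons /=.
rewrite [X in _ - X](perm_big _ (perm_to_rem hb)) big_cons /=.
rewrite !mulr0 !addr0 xb' subrr !mul0r subr0.
move=> /esym/eqP; rewrite mulf_eq0 pnatr_eq0 /= prodf_seq_eq0 => /hasP[v vs /=].
by rewrite mulr0 addr0 det2_eq0_sym => /eqP; exists v.
Qed.

(** At [x = u] the right-hand side of [net_identity] has a simple root at the
    origin. A value taken twice would, by symmetry, give a double root of both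
    products on the left for [T] its opposite. *)
Lemma net_latin s u :
  odd (size s) -> balanced_seq s -> uniform s -> {in s, forall v, v != 0} ->
  u \in s -> uniq [seq det2 u v | v <- s].
Proof.
move=> odd_s bs us s0 hu; apply: count_mem_uniq => r.
have [/mapP[w ws ->]|r_notin] := boolP (r \in _); last exact/count_memPn.
apply/eqP; rewrite eqn_leq -has_count has_pred1 map_f // andbT leqNgt.
apply/negP => h; have [y ys] := exists_generic s0.
have uy : det2 u y != 0 by rewrite det2_neq0_sym ys.
have := net_identity (- det2 u w) odd_s bs us uy ys.
move=> /(congr1 (fun p : {poly R} => p`_1)); rewrite coefB coefZ.
rewrite (@affprod_double_root _ _ s (fun v => - det2 u w + _)); last first.
  move: h; rewrite count_map; congr (1 < _)%N; apply: eq_count => v /=.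
  by rewrite addrC subr_eq0.
rewrite (@affprod_double_root _ _ s (fun v => - det2 u w - _)); last first.
  move: h; rewrite (symm_count _ (bs u hu)) count_map; congr (1 < _)%N.
  by apply: eq_count => v /=; rewrite subr_eq0 eq_sym.
rewrite (perm_affprod _ _ (perm_to_rem hu)) affprod_simple_root ?det2vv //.
move=> /esym/eqP; rewrite subrr mulf_eq0 pnatr_eq0 /= mulf_eq0 (negbTE (ys u hu)) /=.
rewrite prodf_seq_eq0 => /hasP[v vs /= uv].
move: (us u hu); rewrite (permP (perm_to_rem hu)) /= det2vv eqxx add1n ltnS leqNgt.
by rewrite -has_count; move=> /hasP; apply; exists v.
Qed.

End Uniform.

(** * The cyclic order of a uniform balanced configuration *)

Section CyclicOrder.
Context (R : realType).
Implicit Types (s : seq 'cV[R]_2) (u v w x y : 'cV[R]_2).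

Lemma count_nth2 (T : Type) (x0 : T) (p : pred T) (s : seq T) i j :
  (i < j < size s)%N -> p (nth x0 s i) -> p (nth x0 s j) -> (1 < count p s)%N.
Proof.
move=> /andP[ij js] pi pj; rewrite -(cat_take_drop j s) count_cat -[2%N]addn1.
apply: leq_add; rewrite -has_count; apply/(has_nthP x0).
  by exists i; rewrite ?size_takel ?nth_take // ltnW.
by exists 0%N; rewrite ?size_drop ?subn_gt0 // nth_drop addn0.
Qed.

Lemma uniform_nth s i j : uniform s -> (i < size s)%N -> (j < size s)%N -> i != j ->
  det2 (nth 0 s i) (nth 0 s j) != 0.
Proof.
move=> us hi hj ij; apply/negP => h; have := us _ (mem_nth 0 hi); rewrite leqNgt.
move=> /negP; apply; case: (ltngtP i j) ij => // ij _.
  by apply: (count_nth2 (x0 := 0) (i := i) (j := j)); rewrite ?ij ?hj //= det2vv.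
by apply: (count_nth2 (x0 := 0) (i := j) (j := i)); rewrite ?ij ?hi //= det2vv.
Qed.

(** In a regular polygon listed by increasing slope of the lines through the
    origin, consecutive entries lie on opposite sides.  The alternating
    extension undoes this: it turns monotonically, by a half turn in
    [size s] steps. *)
Definition alternating_ext s k : 'cV[R]_2 := (-1) ^+ k *: nth 0 s (k %% size s).

Lemma alternating_extD s q k : odd (size s) ->
  alternating_ext s (q * size s + k) = (-1) ^+ q *: alternating_ext s k.
Proof.
move=> odd_s; rewrite /alternating_ext modnMDl scalerA -exprD; congr (_ *: _).
by rewrite -signr_odd -[RHS]signr_odd !oddD oddM odd_s andbT.
Qed.

(** Shifting both indices by [size s] changes both signs, so [i] may be taken
    below [size s]; if [j] is then beyond it, [j] stands for the opposite of an
    earlier entry, and exchanging the arguments restores the sign. *)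
Lemma alternating_ext_turn s : odd (size s) ->
  (forall i j, (i < j < size s)%N ->
     0 < det2 (alternating_ext s i) (alternating_ext s j)) ->
  forall i j, (i < j < i + size s)%N ->
     0 < det2 (alternating_ext s i) (alternating_ext s j).
Proof.
move=> odd_s pos i j; set n := size s => /andP[ij].
rewrite -(subnKC (ltnW ij)); move: (j - i)%N (subn_gt0 i j) => d.
rewrite ij ltn_add2l {ij} => d0 dn.
have n0 : (0 < n)%N by rewrite /n; case: (size s) odd_s.
rewrite (divn_eq i n) -addnA !alternating_extD //.
rewrite det2Zl det2Zr mulrA -expr2 sqrr_sign mul1r.
have r_lt := ltn_pmod i n0; set r := (i %% n)%N in r_lt *.
have [le_n|gt_n] := ltnP (r + d) n; first by apply: pos; lia.
rewrite -(subnKC gt_n) -{1}[n]mul1n alternating_extD // expr1 scaleN1r.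
by rewrite det2Nr -det2_antisym; apply: pos; lia.
Qed.

(** Listing the lines by increasing slope, [eps k] records on which side of the
    first line the [k]-th vector lies.  Each line has as many vectors on its
    left as on its right, and comparing two consecutive lines forces [eps] to
    alternate. *)
Lemma cyclic_order s : odd (size s) -> balanced_seq s -> uniform s ->
  {in s, forall v, v != 0} ->
  exists2 L, perm_eq s L & forall i j, (i < j < i + size L)%N ->
    0 < det2 (alternating_ext L i) (alternating_ext L j).
Proof.
case: s => [//|b0 s'] odd_s bs us s0.
have b00 : b0 != 0 by apply: s0; rewrite mem_head.
(* [e] completes the first vector to a positively oriented basis, so that the
   slope of [v] is defined and does not depend on the sign of [v]. *)
have [e De] : exists e, 0 < det2 b0 e.
  have [|y hy] := @exists_generic _ [:: b0].
    by move=> v; rewrite inE => /eqP ->.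
  exists (det2 b0 y *: y); rewrite det2Zr -expr2 exprn_even_gt0 //=.
  by rewrite det2_neq0_sym hy // mem_head.
pose slope v := det2 e v / det2 b0 v; pose le u v := slope u <= slope v.
pose L := b0 :: sort le s'; exists L.
  by rewrite perm_cons perm_sym; apply/permPl/perm_sort.
have sL : perm_eq (b0 :: s') L by rewrite perm_cons perm_sym; apply/permPl/perm_sort.
have odd_L : odd (size L) by rewrite -(perm_size sL).
have bL := perm_balanced_seq sL bs; have uL := perm_uniform sL us.
pose n := size L; pose b := nth 0 L.
have nonpar i j : (i < j < n)%N -> det2 (b i) (b j) != 0.
  by move=> /andP[ij jn]; apply: uniform_nth => //; [exact: ltn_trans jn | rewrite ltn_eqF].
pose eps k : R := if k == 0%N then 1 else Num.sg (det2 b0 (b k)).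
have eps_neq0 k : (k < n)%N -> eps k != 0.
  case: k => [_|k kn]; first by rewrite /eps /= oner_neq0.
  by rewrite /eps /= sgr_eq0 (nonpar 0%N).
have sg_det i j : (i < j < n)%N -> Num.sg (det2 (b i) (b j)) = eps i * eps j.
  case: i => [|i] ijn; first by rewrite /eps /= mul1r; case: j ijn.
  have [i_n j_n] : (i.+1 < n)%N /\ (j < n)%N by lia.
  have hi : det2 b0 (b i.+1) != 0 by apply: (nonpar 0%N).
  have hj : det2 b0 (b j) != 0 by apply: (nonpar 0%N); lia.
  have /= slope_le : slope (b i.+1) <= slope (b j).
    case: j ijn j_n {hj} => // j ijn j_n.
    have tr : transitive le by move=> u v w; exact: le_trans.
    have so : sorted le (sort le s') by apply: sort_sorted => u v; exact: le_total.
    have h := sorted_ltn_nth tr 0 so.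
    by apply: h; rewrite ?inE; move: ijn i_n j_n; rewrite /n /L /=; lia.
  have key : det2 b0 e * det2 (b i.+1) (b j) =
      det2 b0 (b i.+1) * det2 b0 (b j) * (slope (b j) - slope (b i.+1)).
    have := det2_plucker b0 e (b i.+1) (b j); rewrite /slope => H.
    transitivity (det2 b0 (b i.+1) * det2 e (b j) - det2 b0 (b j) * det2 e (b i.+1)).
      by lra.
    by field; rewrite hi hj.
  have := congr1 Num.sg key; rewrite !sgrM (gtr0_sg De) mul1r => ->.
  rewrite {1}/eps {1}/eps /= (_ : j == 0%N = false); last by case: j ijn {j_n hj slope_le key}.
  rewrite [X in _ * X]gtr0_sg ?mulr1 // lt_def subr_ge0 slope_le andbT.
  apply: contraNneq (nonpar _ _ ijn) => H; move: key; rewrite H mulr0.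
  by move/eqP; rewrite mulf_eq0 gt_eqF.
have balance j : (j < n)%N -> \sum_(0 <= i < j) eps i = \sum_(j.+1 <= i < n) eps i.
  move=> jn; have := symm_odd_sum (@sgrN _) (bL _ (mem_nth 0 jn)).
  rewrite big_map (big_nth 0) (big_cat_nat (n := j)) ?(ltnW jn) //=.
  rewrite [X in _ + X]big_ltn // -/(b j) det2vv sgr0 add0r => H.
  apply: (mulfI (eps_neq0 j jn)); rewrite !mulr_sumr.
  rewrite [RHS](eq_big_nat _ _ (F2 := fun i => Num.sg (det2 (b j) (b i)))); last first.
    by move=> i ji; rewrite sg_det.
  rewrite [LHS](eq_big_nat _ _ (F2 := fun i => - Num.sg (det2 (b j) (b i)))); last first.
    by move=> i /= ij; rewrite det2_antisym sgrN opprK sg_det ?ij ?jn // mulrC.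
  by rewrite sumrN; apply/eqP; rewrite eq_sym -addr_eq0 addrC; apply/eqP.
have alt j : (j < n)%N -> eps j = (-1) ^+ j.
  elim: j => [_|j IH jn]; first by rewrite /eps expr0.
  have := balance _ jn; have := balance _ (ltnW jn).
  rewrite (big_nat_recr j 0) //= (big_ltn jn) => -> h.
  by rewrite exprS -IH ?(ltnW jn) // mulN1r; lra.
apply: alternating_ext_turn => // i j ijn.
have [i_n j_n] : (i < n)%N /\ (j < n)%N by lia.
have sgb : Num.sg (det2 (b i) (b j)) = (-1) ^+ i * (-1) ^+ j by rewrite sg_det // !alt.
rewrite /alternating_ext !modn_small // det2Zl det2Zr mulrA -/b -sgb.
by rewrite -normrEsg normr_gt0 nonpar.
Qed.

End CyclicOrder.

(** * Rigidity: the configuration is a regular polygon *)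

Section Rigidity.
Context (R : realType).
Implicit Types (s : seq 'cV[R]_2) (u v w x y : 'cV[R]_2) (c : nat -> 'cV[R]_2).

Section Chords.
Context (L : seq 'cV[R]_2).
Let n := size L.
Let b := nth 0 L.
Let c := alternating_ext L.
Hypotheses (odd_n : odd n) (balL : balanced_seq L) (uniL : uniform L).
Hypothesis L0 : {in L, forall v, v != 0}.
Hypothesis turn : forall i j, (i < j < i + n)%N -> 0 < det2 (c i) (c j).

Let n_gt0 : (0 < n)%N. Proof. by case: n odd_n. Qed.

(** By [net_parallel] some entry is parallel to [c i + c j]. Among the [c k] of
    one half turn starting at [c i], those from [c j] on have both [c i] and
    [c j] on the same side, so the entry found is strictly in between. *)
Lemma chord_parallel i j : (i < j < i + n)%N -> odd i = odd j ->
  exists2 k, (i < k < j)%N & det2 (c k) (c i + c j) = 0.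
Proof.
move=> ijn odd_ij; have ij := turn ijn.
have cE : c i + c j = (-1) ^+ i *: (b (i %% n) + b (j %% n)).
  by rewrite /c /alternating_ext scalerDr -[(-1) ^+ j]signr_odd -odd_ij signr_odd.
have bb : det2 (b (i %% n)) (b (j %% n)) != 0.
  apply: contraTneq ij => h; rewrite /c /alternating_ext det2Zl det2Zr h !mulr0.
  by rewrite ltxx.
have mem_b k : b (k %% n) \in L by rewrite mem_nth // ltn_pmod.
have [v /(nthP 0)[k0 k0n <-] h] := net_parallel odd_n balL uniL L0 (mem_b i) (mem_b j) bb.
have [k ik kE] : exists2 k, (i <= k < i + n)%N & (k %% n = k0)%N.
  have [le_k|gt_k] := leqP (i %% n) k0.
    exists (i %/ n * n + k0)%N; last by rewrite modnMDl modn_small.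
    by rewrite {1 4}(divn_eq i n) leq_add2l le_k -addnA ltn_add2l ltn_addl.
  exists ((i %/ n).+1 * n + k0)%N; last by rewrite modnMDl modn_small.
  rewrite {1 4}(divn_eq i n) mulSn -addnA addnCA leq_add2l -addnA ltn_add2l.
  by rewrite addnC ltn_add2r gt_k andbT ltnW // ltn_addl // ltn_pmod.
have {}h : det2 (c k) (c i + c j) = 0.
  by rewrite cE /c /alternating_ext det2Zl det2Zr -/n kE h !mulr0.
exists k => //; move: ik ijn => /andP[ik kin] /andP[lt_ij jin].
have hneg (x y : R) : 0 < x -> 0 < y -> - x - y = 0 -> False by lra.
have [ltik|gtik|eik] := ltngtP i k; [|by rewrite ltnNge ik in gtik|].
  have [//|gtkj|ekj] := ltngtP k j.
    case: (hneg _ _ (turn (i := i) (j := k) _) (turn (i := j) (j := k) _)).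
    - by rewrite ltik.
    - by rewrite gtkj; lia.
    - by rewrite -!det2_antisym -det2Dr.
  by move: h ij; rewrite ekj det2Dr det2vv addr0 det2_antisym; lra.
by move: h ij; rewrite -eik det2Dr det2vv add0r; lra.
Qed.

Lemma chord_latin i j k : (j < k < j + n)%N -> odd j = odd k ->
  det2 (c i) (c j) != det2 (c i) (c k).
Proof.
move=> jk odd_jk; apply/negP; rewrite /c /alternating_ext !det2Zl !det2Zr.
rewrite -[(-1) ^+ k]signr_odd -odd_jk signr_odd.
rewrite !(inj_eq (mulfI _)) ?signr_eq0 //.
have mem_b l : b (l %% n) \in L by rewrite mem_nth // ltn_pmod.
have := net_latin odd_n balL uniL L0 (mem_b i).
have jn := ltn_pmod j n_gt0; have kn := ltn_pmod k n_gt0.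
rewrite -/n -!(nth_map 0 0 (det2 (b (i %% n)))) // => /nth_uniq ->; rewrite ?size_map //.
rewrite eq_sym (eqn_mod_dvd n) ?gtnNdvd //; lia.
Qed.

Lemma side_const i : (2 < n)%N -> det2 (c i) (c i.+1) = det2 (c i.+1) (c i.+2).
Proof.
move=> n2; have [||k ik] := @chord_parallel i i.+2; [lia|by rewrite /= !negbK|].
have -> : k = i.+1 by lia.
by rewrite det2Dr [det2 _ (c i)]det2_antisym; lra.
Qed.

(** A chord spanning four steps is parallel to one of the three vectors in
    between; for the outer two, comparison with the chords spanning two steps
    would contradict [chord_latin]. *)
Lemma diag_const i : (4 < n)%N -> det2 (c i) (c i.+2) = det2 (c i.+2) (c i.+4).
Proof.
move=> n4; have n2 : (2 < n)%N by lia.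
have [||k ik h] := @chord_parallel i i.+4; [lia|by rewrite /= !negbK|].
have : [|| k == i.+1, k == i.+2 | k == i.+3] by lia.
case/or3P => /eqP e; move: h; rewrite e det2Dr.
- have /eqP : det2 (c i.+1) (c i.+2) != det2 (c i.+1) (c i.+4).
    by apply: chord_latin; [lia|rewrite /= !negbK].
  rewrite -side_const // [det2 _ (c i)]det2_antisym => ne h.
  by case: ne; lra.
- by rewrite [det2 _ (c i)]det2_antisym; lra.
have /eqP : det2 (c i.+3) (c i) != det2 (c i.+3) (c i.+2).
  by apply: chord_latin; [lia|rewrite /= !negbK].
rewrite [det2 _ (c i.+2)]det2_antisym side_const // => ne h.
by case: ne; lra.
Qed.

(** [side_const] and [diag_const] give the coefficients of [c i.+2] in the basis
    [c i], [c i.+1]. The second one only compares indices of equal parity, which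
    is enough because [c] changes sign after an odd number [n] of steps. *)
Lemma three_term_recurrence : (4 < n)%N ->
  exists a, forall i, c i + c i.+2 = a *: c i.+1.
Proof.
move=> n4; pose d := det2 (c 0%N) (c 1%N).
have d0 : 0 < d by apply: turn; lia.
have side i : det2 (c i) (c i.+1) = d.
  by elim: i => // i <-; rewrite -side_const //; lia.
pose e i := det2 (c i) (c i.+2).
have e_even i m : e (m.*2 + i)%N = e i.
  by elim: m => // m <-; rewrite doubleS !addSn /e -diag_const.
have e_n i : e (n + i)%N = e i.
  have cN k : c (n + k) = - c k.
    by rewrite -[n]mul1n /c alternating_extD // expr1 scaleN1r.
  by rewrite /e -!addnS !cN det2Nl det2Nr opprK.
have eS i : e i.+1 = e i.
  by rewrite -[RHS]e_n -(odd_double_half n) odd_n add1n addSnnS e_even.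
have eE i : e i = e 0%N by elim: i => // i <-.
exists (e 0%N / d) => i; apply: (scalerI (lt0r_neq0 d0)).
rewrite scalerA mulrCA divff ?lt0r_neq0 // mulr1 -(eE i) scalerDr.
have := det2_cramer (c i) (c i.+1) (c i.+2).
by rewrite [det2 (c i.+2) _]det2_antisym !side => ->; rewrite scaleNr addNKr.
Qed.

End Chords.

Lemma polar_recurrence (r t h : R) :
  polar r t + polar r (t + h + h) = (2 * cos h) *: polar r (t + h).
Proof.
rewrite [polar r t](_ : _ = polar r (t + h - h)); last by rewrite addrK.
apply: eq_col2; rewrite !mxE /= !(cosD, sinD, cosN, sinN); ring.
Qed.

Lemma det2_polar (r r' t t' : R) : det2 (polar r t) (polar r' t') = r * r' * sin (t' - t).
Proof. by rewrite det2E !mxE /= sinB; ring. Qed.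

(** A solution of a three-term recurrence with constant coefficient [a] is a
    linear image of points on a circle as soon as [a = 2 * cos th].  Positivity
    over a half turn of [n] steps forces such a [th] to exist and to be
    [pi / n]. *)
Lemma recurrence_circle c (a : R) n : (2 < n)%N ->
  (forall i, c i + c i.+2 = a *: c i.+1) ->
  (forall k, (0 < k < n)%N -> 0 < det2 (c 0%N) (c k)) -> c n = - c 0%N ->
  exists2 g : 'M[R]_2, g \in unitmx &
    forall k, g *m c k = polar 1 (k%:R * (pi / n%:R)).
Proof.
move=> n2 rec pos cn; pose d k := det2 (c 0%N) (c k).
have d0 : d 0%N = 0 by rewrite /d det2vv.
have d1 : 0 < d 1%N by apply: pos; lia.
have dn : d n = 0 by rewrite /d cn det2Nr det2vv oppr0.
have drec k : d k.+2 = a * d k.+1 - d k.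
  rewrite /d -det2Zr -rec det2Dr; ring.
have a_gt0 : 0 < a.
  have : 0 < d 2%N by apply: pos; lia.
  by rewrite drec d0 subr0 pmulr_lgt0.
(* For a >= 2 the determinants would increase forever, but d n = 0. *)
have a_lt2 : a < 2.
  rewrite ltNge; apply/negP => a2.
  have incr k : 0 <= d k /\ d 1%N <= d k.+1 - d k.
    elim: k => [|k [dk h]]; first by rewrite d0 subr0 lexx.
    have dk1 : 0 <= d k.+1 by lra.
    split=> //; rewrite drec; have : 0 <= (a - 2) * d k.+1 by apply: mulr_ge0; lra.
    by lra.
  by have := incr n.-1; rewrite prednK ?dn; [lra | lia].
have a_itv : -1 <= a / 2 < 1 by lra.
pose th := acos (a / 2).
have cos_th : 2 * cos th = a by rewrite /th acosK ?in_itv /=; lra.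
have th_gt0 : 0 < th by apply: acos_gt0.
have th_ltpi : th < pi by apply: acos_ltpi; lra.
have sin_th : 0 < sin th by apply: sin_gt0_pi; rewrite th_gt0.
have sinE k : d k * sin th = d 1%N * sin (k%:R * th).
  have [] // : d k * sin th = d 1%N * sin (k%:R * th) /\
       d k.+1 * sin th = d 1%N * sin (k.+1%:R * th).
  elim: k => [|k [IH1 IH2]]; first by rewrite d0 !mul0r sin0 mulr0 mul1r.
  split=> //; rewrite drec mulrBl -mulrA IH1 IH2 -cos_th.
  rewrite (_ : k.+2%:R * th = k.+1%:R * th + th); last by rewrite -[k.+2]addn1 natrD; ring.
  rewrite (_ : k%:R * th = k.+1%:R * th - th); last by rewrite -[k.+1]addn1 natrD; ring.
  by rewrite sinB sinD; ring.
(* One step is shorter than a half turn, so the first multiple of th beyond pi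
   would have a negative sine. *)
have below k : (k < n)%N -> k%:R * th < pi.
  elim: k => [_|k IH kn]; first by rewrite mul0r pi_gt0.
  have {}IH := IH (ltnW kn); rewrite ltNge; apply/negP => ge_pi.
  have : 0 < d k.+1 * sin th by rewrite mulr_gt0 // pos.
  rewrite sinE pmulr_rgt0 // -[_ * th](subrK pi) sinDpi oppr_gt0 ltNge.
  rewrite sin_ge0_pi // subr_ge0 ge_pi /=.
  by move: IH th_ltpi; rewrite -[k.+1]addn1 natrD; lra.
have thE : th = pi / n%:R.
  have nth : n%:R * th = pi.
    have lt2 : (n.-1)%:R * th < pi by apply: below; lia.
    have nE : n%:R = (n.-1)%:R + 1 :> R by rewrite natr1 prednK //; lia.
    have npos : 0 < n%:R * th by rewrite mulr_gt0 // ltr0n; lia.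
    have sin0n : sin (n%:R * th) = 0.
      by apply: (mulfI (lt0r_neq0 d1)); rewrite -sinE dn mul0r mulr0.
    have [lt_pi|gt_pi|//] := ltgtP (n%:R * th) pi.
      by have := sin_gt0_pi (x := n%:R * th); rewrite npos lt_pi sin0n ltxx => /(_ isT).
    have : 0 < sin (n%:R * th - pi).
      by apply: sin_gt0_pi; rewrite subr_gt0 gt_pi; move: lt2 th_ltpi; rewrite nE; lra.
    by rewrite -[n%:R * th](subrK pi) sinDpi in sin0n; lra.
  by rewrite -nth mulrAC divff ?mul1r // pnatr_eq0; lia.
have [||g gu [g0 g1]] := @exists_gl2 _ (c 0%N) (c 1%N) (polar 1 0) (polar 1 th).
- exact: lt0r_neq0.
- by rewrite det2_polar !mul1r subr0 lt0r_neq0.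
exists g => // k; rewrite -thE.
have [] // : g *m c k = polar 1 (k%:R * th) /\ g *m c k.+1 = polar 1 (k.+1%:R * th).
elim: k => [|k [IH1 IH2]]; first by rewrite mul0r mul1r.
split=> //; apply: (addrI (g *m c k)); rewrite -mulmxDr rec -scalemxAr IH2 IH1.
have thS m : m.+1%:R * th = m%:R * th + th by rewrite -natr1 mulrDl mul1r.
by rewrite -cos_th !thS polar_recurrence.
Qed.

(** An odd [n] divides [2 * (j - i)] only if it divides [j - i], so doubling is
    injective on residues. *)
Lemma perm_double_mod n : odd n ->
  perm_eq [seq (2 * j) %% n | j <- iota 0 n]%N (iota 0 n).
Proof.
move=> odd_n; have n0 : (0 < n)%N by case: n odd_n.
have inj : {in iota 0 n &, injective (fun j => (2 * j) %% n)%N}.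
  suff H i j : (i <= j < n)%N -> (2 * i = 2 * j %[mod n])%N -> i = j.
    move=> i j; rewrite !mem_iota !add0n /= => hi hj e.
    by case: (leqP i j) => ij; [|apply/esym]; apply: H; rewrite ?ij ?(ltnW ij).
  move=> /andP[ij jn] /eqP; rewrite eq_sym eqn_mod_dvd ?leq_mul2l //.
  rewrite -mulnBr Gauss_dvdr ?coprimen2 // => h.
  apply/eqP; rewrite eqn_leq ij /= -subn_eq0; apply: contraLR h => h.
  by rewrite gtnNdvd ?lt0n //; lia.
have u : uniq [seq (2 * j) %% n | j <- iota 0 n]%N by rewrite map_inj_in_uniq ?iota_uniq.
apply: uniq_perm; rewrite ?iota_uniq //.
apply: (uniq_min_size u _ _).2; last by rewrite size_map.
by move=> k /mapP[j _ ->]; rewrite mem_iota /= add0n ltn_pmod.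
Qed.

(** The signs in [alternating_ext] disappear at even indices, and these reach
    every entry because the size is odd. *)
Theorem uniform_balanced_regular s : odd (size s) -> (4 < size s)%N ->
  balanced_seq s -> uniform s ->
  exists2 P : (size s).-tuple 'cV[R]_2, regular_polygon P & GL2_equiv s P.
Proof.
move=> odd_s s4 bs us.
have s0 : {in s, forall v, v != 0}.
  move=> v vs; apply: contraTneq (us v vs) => ->; rewrite -ltnNge.
  rewrite (eq_count (a2 := predT)) ?count_predT; first by lia.
  by move=> w; rewrite det2E !mxE !mul0r subrr eqxx.
have [L sL turn] := cyclic_order odd_s bs us s0.
have sz := perm_size sL; rewrite sz in odd_s s4 *.
have L0 : {in L, forall v, v != 0} by move=> v; rewrite -(perm_mem sL); exact: s0.
have bL := perm_balanced_seq sL bs; have uL := perm_uniform sL us.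
have [a rec] := three_term_recurrence odd_s bL uL L0 turn s4.
have [||||g gu gE] := @recurrence_circle (alternating_ext L) a (size L).
- by lia.
- by [].
- by move=> k k0; apply: turn; lia.
- by have := alternating_extD 1 0 odd_s; rewrite mul1n addn0 expr1 scaleN1r.
pose P := [seq polar 1 (0 + 2 * pi * j%:R / (size L)%:R) : 'cV[R]_2 | j <- iota 0 (size L)].
have szP : size P == size L by rewrite size_map size_iota.
exists (Tuple szP); first by exists 1, 0.
exists g => //=.
have -> : P = [seq g *m nth 0 L k | k <- [seq (2 * j) %% size L | j <- iota 0 (size L)]%N].
  rewrite -map_comp; apply: eq_map => j /=; rewrite add0r.
  have := gE (2 * j)%N; rewrite /alternating_ext exprM sqrrN expr1n expr1n scale1r => ->.
  by congr (polar _ _); rewrite natrM; ring.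
rewrite (permPl (perm_map _ sL)) perm_sym (permPl (perm_map _ (perm_double_mod odd_s))).
by rewrite map_comp map_nth_iota0 // take_size.
Qed.

End Rigidity.

(** * Three vectors on a line and four others *)

Section ThreeOnALine.
Context (R : realType).
Implicit Types (u v w : 'cV[R]_2).

Lemma symm_map_cons (T : eqType) (f : T -> R) x r : f x != 0 ->
  symm [seq f y | y <- x :: r] ->
  exists x' r', [/\ perm_eq r (x' :: r'), f x' = - f x & symm [seq f y | y <- r']].
Proof.
move=> fx0 h; have [l hl _] := symm_cons fx0 h.
have : - f x \in map f r by rewrite (perm_mem hl) mem_head.
case/mapP => x' x'r fx'; have hr := perm_to_rem x'r.
exists x', (rem x' r); split=> //; rewrite -(symm_pair (f x)) fx'.
by rewrite -(perm_symm (perm_map f (_ : perm_eq (x :: r) (x :: x' :: rem x' r)))) ?perm_cons.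
Qed.

Lemma perm2P (a b c d : R) : perm_eq [:: a; b] [:: c; d] ->
  (a = c /\ b = d) \/ (a = d /\ b = c).
Proof.
move=> h; have := perm_mem h a; rewrite mem_head !inE => /esym/orP[]/eqP e.
  by left; move: h; rewrite e perm_cons => /(@perm_small_eq _ _ [:: _] isT)[].
right; split=> //; have : perm_eq [:: b] [:: c].
  by rewrite -(perm_cat2l [:: a]) /= (permPl h) e; apply/permP => P /=; ring.
by move=> /(@perm_small_eq _ _ [:: _] isT)[].
Qed.

(** The [d]'s are the determinants of four vectors whose determinants with a
    vector [u] are [p], [- p], [q], [- q]; the two equations are Pluecker
    relations. The permutations leave only [d23 = - d14] and [d24 = - d13], the
    relations then express [d12] and [d34] through [d13] and [d14], and the two
    lists [[:: q * d12; q * d13; q * d14]] and [[:: - (p * d13); p * d14; p * d34]],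
    both multiples of [ts], cannot be matched. *)
Lemma no_proportional_rows (p q d12 d13 d14 d23 d24 d34 : R) (ts : seq R) :
  p != 0 -> q != 0 -> p + q != 0 ->
  (forall x y, x \in ts -> y \in ts -> x + y != 0) ->
  perm_eq [:: d12; d13; d14] [seq t * p | t <- ts] ->
  perm_eq [:: - d13; - d23; d34] [seq t * q | t <- ts] ->
  perm_eq [:: d14; d24; d34] [seq t * q | t <- ts] ->
  p * d23 + p * d13 + q * d12 = 0 -> p * d34 - q * d14 - q * d13 = 0 -> False.
Proof.
move=> p0 q0 pq0 no_opp h1 h3 h4 rel1 rel2.
have in_ts d : d \in [:: d12; d13; d14] -> exists2 t, t \in ts & d = t * p.
  by rewrite (perm_mem h1) => /mapP.
have [a ats ha] : exists2 t, t \in ts & d13 = t * p by apply: in_ts; rewrite !inE eqxx orbT.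
have [b bts hb] : exists2 t, t \in ts & d14 = t * p by apply: in_ts; rewrite !inE eqxx !orbT.
have A0 : d13 != 0.
  rewrite ha mulf_neq0 //; apply: contraNneq (no_opp _ _ ats ats) => ->.
  by rewrite addr0.
have B0 : d14 != 0.
  rewrite hb mulf_neq0 //; apply: contraNneq (no_opp _ _ bts bts) => ->.
  by rewrite addr0.
have : perm_eq [:: - d13; - d23] [:: d14; d24].
  by rewrite -(perm_cat2r [:: d34]) /= (permPr h4).
case/perm2P => -[e1 e2].
  have := no_opp _ _ ats bts; rewrite -(inj_eq (mulIf p0)) mulrDl mul0r -ha -hb.
  by rewrite -e1 addrN eqxx.
have h : perm_eq [:: q * d12; q * d13; q * d14] [:: - (p * d13); p * d14; p * d34].
  apply: (perm_trans (perm_map ( *%R q) h1)).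
  have := perm_map ( *%R p) h3; rewrite /= e2 mulrN => /permPr ->.
  by rewrite -!map_comp (eq_map (g := *%R p \o *%R^~ q)) // => t /=; ring.
have {rel2}e34 : p * d34 = q * d14 + q * d13 by lra.
have {rel1}e12 : q * d12 = p * d14 - p * d13.
  by move: rel1; rewrite (_ : d23 = - d14); [lra | rewrite -e2 opprK].
have := perm_mem h (p * d34); rewrite !inE eqxx !orbT => /or3P[]/eqP e.
- have {}h : perm_eq [:: q * d13; q * d14] [:: - (p * d13); p * d14].
    rewrite -(perm_cat2l [:: p * d34]) /= {1}e (permPl h).
    by apply/permP => P /=; ring.
  case: (perm2P h) => -[h13 h14].
    move/eqP: A0; apply; apply: (mulfI pq0); rewrite mulr0; lra.
  move/eqP: A0; apply; apply: (mulfI (_ : p ^+ 2 + q ^+ 2 != 0)).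
    by rewrite paddr_eq0 ?sqr_ge0 // !sqrf_eq0 negb_and p0.
  rewrite mulr0 mulrDl !expr2 -!mulrA h13 [q * (p * _)]mulrCA h14; ring.
- move/eqP: B0; apply; apply: (mulfI q0); rewrite mulr0; lra.
move/eqP: A0; apply; apply: (mulfI q0); rewrite mulr0; lra.
Qed.

(** If no two of the [ts] are opposite, then for each of the four remaining
    vectors the three determinants with the others are matched with the three
    determinants with the line, and [no_proportional_rows] applies. *)
Lemma three_collinear_opposite (u : 'cV[R]_2) (ts : seq R) (r : seq 'cV[R]_2) :
  size ts = 3%N -> size r = 4%N -> all (fun t => t != 0) ts ->
  {in r, forall v, det2 u v != 0} -> balanced_seq ([seq t *: u | t <- ts] ++ r) ->
  exists c t, perm_eq ts [:: c; t; - t].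
Proof.
move=> sz_ts sz_r ts0 r0 bs; set s := _ ++ r in bs.
have [/hasP[x xts /hasP[y yts /eqP xy]]|no_opp] :=
    boolP (has (fun x => has (fun y => x + y == 0) ts) ts).
  have x0 := allP ts0 x xts; have hx := perm_to_rem xts.
  have : y \in rem x ts.
    move: yts; rewrite (perm_mem hx) inE => /predU1P[yx|//].
    by move: xy x0; rewrite yx => h; rewrite (_ : x = 0) ?eqxx //; lra.
  move=> /perm_to_rem hy; have := perm_size hx; have := perm_size hy.
  rewrite sz_ts /= => -> []; case: (rem y _) hy => [//|c [|//]] hy _.
  exists c, x; rewrite (permPl hx); have -> : - x = y by lra.
  by apply/permP => P; rewrite /= (permP hy) /=; ring.
have {}no_opp x y : x \in ts -> y \in ts -> x + y != 0.
  move=> xts yts; apply: contraNN no_opp => xy.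
  by apply/hasP; exists x => //; apply/hasP; exists y.
exfalso.
have [t tts] : exists t, t \in ts by case: ts sz_ts {s bs ts0 no_opp} => // t; exists t; rewrite mem_head.
have t0 := allP ts0 t tts.
have symr : symm [seq det2 u v | v <- r].
  have : t *: u \in s by rewrite mem_cat (map_f (fun a => a *: u)).
  move=> /bs; rewrite map_cat symm_cat0; last first.
    by rewrite -map_comp all_map; apply/allP => a _ /=; rewrite det2Zl det2Zr det2vv !mulr0.
  rewrite (eq_map (g := ( *%R t) \o det2 u)); last by move=> v; rewrite det2Zl.
  by rewrite map_comp symm_scale.
have row w x y z : perm_eq r [:: w; x; y; z] ->
    perm_eq [:: det2 w x; det2 w y; det2 w z] [seq a * det2 u w | a <- ts].
  move=> hr; have wr : w \in r by rewrite (perm_mem hr) mem_head.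
  have : w \in s by rewrite mem_cat wr orbT.
  have Ew : [seq det2 w v | v <- [seq a *: u | a <- ts]] = [seq a * det2 w u | a <- ts].
    by rewrite -map_comp; apply: eq_map => a /=; rewrite det2Zr.
  move=> /bs; rewrite map_cat Ew.
  rewrite (perm_symm (l2 := 0 :: [seq a * det2 w u | a <- ts] ++ [:: det2 w x; det2 w y; det2 w z])).
    rewrite symm_cons0 => /symm_halves; rewrite size_map sz_ts => /(_ erefl) h.
    rewrite (permPl (h _)); last first.
      move=> _ _ /mapP[a ats ->] /mapP[b bts ->]; rewrite -mulrDl mulf_neq0 ?no_opp //.
      by rewrite det2_neq0_sym r0.
    rewrite -map_comp (eq_map (g := fun a => a * det2 u w)) // => a /=.
    by rewrite -mulrN -det2_antisym.
  by apply/permP => P; rewrite /= !count_cat (permP (perm_map _ hr)) /= det2vv; ring.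
have [u1 [u2 [u3 [u4 [hr e2 e4]]]]] : exists u1 u2 u3 u4,
    [/\ perm_eq r [:: u1; u2; u3; u4], det2 u u2 = - det2 u u1 & det2 u u4 = - det2 u u3].
  case: r sz_r r0 symr {s bs row} => [//|u1 r] [sz_r] r0.
  case/symm_map_cons; first by rewrite r0 ?mem_head.
  move=> u2 [r' [hr e2]]; have := perm_size hr; rewrite sz_r.
  case: r' hr => [//|u3 r'] hr [sz_r'].
  case/symm_map_cons; first by rewrite r0 // inE (perm_mem hr) !inE eqxx !orbT.
  move=> u4 [r'' [hr' e4 _]]; have := perm_size hr'; rewrite -sz_r'.
  case: r'' hr' => [|//] hr' _; exists u1, u2, u3, u4; split=> //.
  by rewrite perm_cons (permPl hr) !perm_cons.
(* Exchanging the last two vectors replaces q by - q. *)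
have {u3 u4 hr e4}[u3 [u4 [hr e4 pq0]]] : exists u3 u4,
    [/\ perm_eq r [:: u1; u2; u3; u4], det2 u u4 = - det2 u u3 &
        det2 u u1 + det2 u u3 != 0].
  have [pq0|pq0] := eqVneq (det2 u u1 + det2 u u3) 0; last by exists u3, u4.
  exists u4, u3; rewrite e4 opprK; split=> //.
    by rewrite (permPl hr); apply/permP => P /=; ring.
  have : det2 u u1 != 0 by rewrite r0 // (perm_mem hr) mem_head.
  by apply: contraNneq => h; apply/eqP; lra.
have p0 : det2 u u1 != 0 by rewrite r0 // (perm_mem hr) mem_head.
have q0 : det2 u u3 != 0 by rewrite r0 // (perm_mem hr) !inE eqxx !orbT.
have row1 := row _ _ _ _ hr.
have row3 : perm_eq [:: det2 u3 u1; det2 u3 u2; det2 u3 u4] [seq a * det2 u u3 | a <- ts].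
  by apply: row; rewrite (permPl hr); apply/permP => P /=; ring.
have row4 : perm_eq [:: det2 u4 u1; det2 u4 u2; det2 u4 u3] [seq a * det2 u u4 | a <- ts].
  by apply: row; rewrite (permPl hr); apply/permP => P /=; ring.
apply: (no_proportional_rows p0 q0 pq0 no_opp row1 (d23 := det2 u2 u3)
  (d24 := det2 u2 u4) (d34 := det2 u3 u4)).
- by rewrite -!det2_antisym.
- have := perm_map -%R row4; rewrite /= -!det2_antisym -map_comp => /permPl ->.
  by rewrite (eq_map (g := fun a => a * det2 u u3)) // => a /=; rewrite e4; ring.
- by have := det2_plucker u u1 u2 u3; rewrite e2; lra.
by have := det2_plucker u u1 u3 u4; rewrite e4; lra.
Qed.

End ThreeOnALine.

(** * Classification by the sizes of the lines *)

Section Classification.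
Context (R : realType).
Implicit Types (s r : seq 'cV[R]_2) (u v w z : 'cV[R]_2) (ts : seq R).

Lemma GL2_equiv_perm s s' C : perm_eq s s' -> GL2_equiv s' C -> GL2_equiv s C.
Proof.
by move=> h [g gu gC]; exists g => //; rewrite (permPl (perm_map _ h)).
Qed.

Lemma balanced_seq_of_balanced n (B : n.-tuple 'cV[R]_2) : balanced B -> balanced_seq B.
Proof.
move=> hB u /tnthP[j ->]; have := hB j; rewrite -/(symm _) -symm_cons0.
apply: etrans; apply: perm_symm; rewrite -{1}(map_tnth_enum B) -map_comp.
rewrite (permPl (perm_map _ (perm_to_rem (mem_enum _ j)))) /= det2vv perm_cons.
by rewrite rem_filter ?enum_uniq.
Qed.

(** The vectors off the line give an even number of non-zero determinants. *)
Lemma odd_line s u : odd (size s) -> balanced_seq s -> u \in s ->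
  odd (count (fun v => det2 u v == 0%R) s).
Proof.
move=> odd_s bs us; have := symm_even_nonzero (bs u us).
rewrite count_map => h; move: odd_s.
by rewrite -(count_predC (fun v => det2 u v == 0)) oddD (negbTE h) addbF.
Qed.

Lemma split_line s u : u != 0 -> {in s, forall v, v != 0} ->
  exists ts, [/\ all (fun t => t != 0) ts, size ts = count (fun v => det2 u v == 0%R) s &
    perm_eq s ([seq t *: u | t <- ts] ++ [seq v <- s | det2 u v != 0])].
Proof.
move=> u0 s0; have [|y hy] := @exists_generic _ [:: u].
  by move=> v; rewrite inE => /eqP ->.
have yu : det2 y u != 0 by rewrite hy ?mem_head.
pose coef v := det2 y v / det2 y u.
have coefE v : det2 u v = 0 -> coef v *: u = v.
  by move=> /eqP/(parallelP _ u0)[a ->]; rewrite /coef det2Zr mulfK.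
pose l := [seq v <- s | det2 u v == 0].
have lE : [seq t *: u | t <- [seq coef v | v <- l]] = l.
  rewrite -map_comp -[RHS]map_id; apply/eq_in_map => v.
  by rewrite mem_filter => /andP[/eqP uv _]; exact: coefE.
exists [seq coef v | v <- l]; split.
- apply/allP => _ /mapP[v + ->]; rewrite mem_filter => /andP[/eqP uv /s0].
  by apply: contraNneq => h; rewrite -(coefE v uv) h scale0r.
- by rewrite size_map size_filter.
by rewrite lE perm_sym; apply/permPl/perm_filterC.
Qed.

Lemma symm4 l : symm l -> size l = 4%N -> all (fun x : R => x != 0) l ->
  exists a b, [/\ a != 0, b != 0 & perm_eq l [:: a; - a; b; - b]].
Proof.
case: l => [//|a l] h [sz] /=/andP[a0 l0].
have [l' hl hl'] := symm_cons a0 h; have := perm_size hl; rewrite sz.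
case: l' hl hl' => [//|b l'] hl h' [sz'].
have b0 : b != 0 by apply: (allP l0); rewrite (perm_mem hl) !inE eqxx orbT.
have [l'' hl' _] := symm_cons b0 h'; have := perm_size hl'; rewrite -sz'.
case: l'' hl' => [|//] hl' _; exists a, b; split=> //.
by rewrite perm_cons (permPl hl) !perm_cons.
Qed.

Lemma symm2 l : symm l -> size l = 2%N -> all (fun x : R => x != 0) l ->
  exists2 a, a != 0 & perm_eq l [:: a; - a].
Proof.
case: l => [//|a l] h [sz] /=/andP[a0 l0].
have [l' hl _] := symm_cons a0 h; have := perm_size hl; rewrite sz.
by case: l' hl => [|//] hl _; exists a; rewrite ?perm_cons.
Qed.

(** Symmetry at the vectors of the line puts [v + w = k *: u] on the line; at
    [v] it makes [k :: ts] symmetric. *)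
Lemma balanced_five_one_one u v w ts : size ts = 5%N -> all (fun t => t != 0) ts ->
  det2 u v != 0 -> balanced_seq ([seq t *: u | t <- ts] ++ [:: v; w]) ->
  exists lambda mu : R, [/\ lambda != 0, mu != 0 &
    GL2_equiv ([seq t *: u | t <- ts] ++ [:: v; w])
      [:: e1 R; e2 R; - e1 R - e2 R;
          lambda *: e1 R; - (lambda *: e1 R);
          mu *: e1 R; - (mu *: e1 R)]].
Proof.
move=> sz ts0 uv bs; have u0 := det2_neq0l uv.
have [k vwE] : exists k, v + w = k *: u.
  apply/parallelP => //; case: ts sz ts0 bs => [//|t ts] _ /=/andP[t0 _] bs.
  have := symm_sum (bs _ (mem_head _ _)).
  rewrite /= map_cat big_cons big_cat -map_comp !big_map /= big1; last first.
    by move=> i _; rewrite det2Zl det2Zr det2vv !mulr0.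
  rewrite det2vv !big_cons big_nil addr0 !add0r -det2Dr det2Zl => /eqP.
  by rewrite mulf_eq0 (negbTE t0).
have wE : w = k *: u - v by rewrite -vwE addrC addKr.
have vu : det2 v u != 0 by rewrite det2_neq0_sym.
have symk : symm (k :: ts).
  have /bs : v \in [seq t *: u | t <- ts] ++ [:: v; w].
    by rewrite mem_cat !inE eqxx orbT.
  rewrite (perm_symm (l2 := 0 :: [seq det2 v u * t | t <- k :: ts])).
    by rewrite symm_cons0 symm_scale.
  have Ev : [seq det2 v x | x <- [seq t *: u | t <- ts]] = [seq det2 v u * t | t <- ts].
    by rewrite -map_comp; apply: eq_map => t /=; rewrite det2Zr mulrC.
  have -> : map (det2 v) ([seq t *: u | t <- ts] ++ [:: v; w]) =
      [seq det2 v u * t | t <- ts] ++ [:: 0; det2 v u * k].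
    by rewrite map_cat Ev /= det2vv wE det2Dr det2Zr det2Nr det2vv subr0 [k * _]mulrC.
  by apply/permP => P; rewrite count_cat /=; ring.
have k0 : k != 0.
  apply: contraTneq symk => ->; rewrite symm_cons0; apply/negP => /(symm_even_size ts0).
  by rewrite sz.
have [l hts hl] := symm_cons k0 symk.
have [||a [b [a0 b0 hl']]] := symm4 hl.
- by have := perm_size hts; rewrite sz => -[].
- by have := ts0; rewrite (perm_all _ hts) /= => /andP[].
have [||g gu [gu1 gv]] := @exists_gl2 _ (- k *: u) v (e1 R) (e2 R).
- by rewrite det2Zl mulf_neq0 ?oppr_eq0.
- by rewrite det2E !mxE /= mulr0 subr0 mulr1 oner_neq0.
have gE t : g *m (t *: u) = (t / - k) *: e1 R.
  by rewrite -gu1 -!scalemxAr scalerA divfK ?oppr_eq0.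
exists (a / - k), (b / - k); split; rewrite ?mulf_neq0 ?invr_eq0 ?oppr_eq0 //.
exists g => //; rewrite map_cat -map_comp.
have h : perm_eq ts [:: - k; a; - a; b; - b] by rewrite (permPl hts) perm_cons.
have gw : g *m w = - e1 R - e2 R.
  rewrite wE mulmxBr gv -scalemxAr -gu1 -scalemxAr.
  by rewrite scaleNr opprK.
rewrite (permPl (perm_cat (perm_map _ h) (perm_refl _))) /= !gE gv gw.
rewrite divff ?oppr_eq0 // scale1r !mulNr !scaleNr.
by apply/permP => P /=; ring.
Qed.

(** Write [z = al *: u + be *: w]. Symmetry at the multiples of [u] says that
    [be :: bs] is symmetric, at the multiples of [w] that [al :: ts] is. *)
Lemma balanced_three_three_one u w z ts bs : size ts = 3%N -> size bs = 3%N ->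
  all (fun t => t != 0) ts -> all (fun t => t != 0) bs ->
  det2 u w != 0 -> det2 u z != 0 -> det2 w z != 0 ->
  balanced_seq ([seq t *: u | t <- ts] ++ [seq t *: w | t <- bs] ++ [:: z]) ->
  exists lambda mu : R, [/\ lambda != 0, mu != 0 &
    GL2_equiv ([seq t *: u | t <- ts] ++ [seq t *: w | t <- bs] ++ [:: z])
      [:: e1 R; e2 R; - e1 R - e2 R;
          lambda *: e1 R; - (lambda *: e1 R);
          mu *: e2 R; - (mu *: e2 R)]].
Proof.
move=> szt szb ts0 bs0 uw uz wz balB.
have wu : det2 w u != 0 by rewrite det2_neq0_sym.
pose al := det2 z w / det2 u w; pose be := det2 u z / det2 u w.
have zE : z = al *: u + be *: w.
  apply: (scalerI uw); rewrite scalerDr !scalerA ![det2 u w * _]mulrC !divfK //.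
  exact: det2_cramer.
have al0 : al != 0 by rewrite mulf_neq0 ?invr_eq0 // det2_neq0_sym.
have be0 : be != 0 by rewrite mulf_neq0 ?invr_eq0.
have detmap x y (l : seq R) : [seq det2 x v | v <- [seq t *: y | t <- l]] = [seq det2 x y * t | t <- l].
  by rewrite -map_comp; apply: eq_map => t /=; rewrite det2Zr mulrC.
have all0 (l : seq R) : all (pred1 0) [seq 0 * t : R | t <- l].
  by rewrite all_map; apply/allP => t _ /=; rewrite mul0r.
have symb : symm (be :: bs).
  case: ts szt ts0 balB => [//|t ts] _ /=/andP[t0 _] /(_ _ (mem_head _ _)).
  rewrite /= det2vv symm_cons0 !map_cat !detmap /= !det2Zl det2vv mulr0.
  rewrite symm_cat0 // (perm_symm (l2 := [seq (t * det2 u w) * x | x <- be :: bs])).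
    by rewrite symm_scale // mulf_neq0.
  rewrite /= (_ : t * det2 u z = t * det2 u w * be).
    by apply/permP => P; rewrite count_cat /=; ring.
  by rewrite zE det2Dr !det2Zr det2vv; ring.
have symt : symm (al :: ts).
  case: bs szb bs0 balB {symb} => [//|b bs] _ /=/andP[b0 _] balB.
  have /balB : b *: w \in [seq t *: u | t <- ts] ++ b *: w :: [seq t *: w | t <- bs] ++ [:: z].
    by rewrite mem_cat mem_head orbT.
  rewrite !map_cat /= map_cat !detmap /= det2vv !det2Zl det2vv mulr0.
  rewrite (perm_symm (l2 := 0 :: [seq 0 * t | t <- bs] ++ [seq (b * det2 w u) * x | x <- al :: ts])).
    by rewrite symm_cons0 symm_cat0 // symm_scale // mulf_neq0.
  rewrite /= (_ : b * det2 w z = b * det2 w u * al).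
    by apply/permP => P; rewrite /= !count_cat /= !count_cat /=; ring.
  by rewrite zE det2Dr !det2Zr det2vv; ring.
have [l hts hl] := symm_cons al0 symt; have [l' hbs hl'] := symm_cons be0 symb.
have [||a a0 hla] := symm2 hl.
- by have := perm_size hts; rewrite szt => -[].
- by have := ts0; rewrite (perm_all _ hts) /= => /andP[].
have [||b b0 hlb] := symm2 hl'.
- by have := perm_size hbs; rewrite szb => -[].
- by have := bs0; rewrite (perm_all _ hbs) /= => /andP[].
have [||g gu [gu1 gw1]] := @exists_gl2 _ (- al *: u) (- be *: w) (e1 R) (e2 R).
- by rewrite det2Zl det2Zr !mulf_neq0 ?oppr_eq0.
- by rewrite det2E !mxE /= mulr0 subr0 mulr1 oner_neq0.
have guE t : g *m (t *: u) = (t / - al) *: e1 R.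
  by rewrite -gu1 -!scalemxAr scalerA divfK ?oppr_eq0.
have gwE t : g *m (t *: w) = (t / - be) *: e2 R.
  by rewrite -gw1 -!scalemxAr scalerA divfK ?oppr_eq0.
exists (a / - al), (b / - be); split; rewrite ?mulf_neq0 ?invr_eq0 ?oppr_eq0 //.
exists g => //; rewrite !map_cat -!map_comp.
have ht : perm_eq ts [:: - al; a; - a] by rewrite (permPl hts) perm_cons.
have hb : perm_eq bs [:: - be; b; - b] by rewrite (permPl hbs) perm_cons.
have gz : g *m z = - e1 R - e2 R.
  by rewrite zE mulmxDr guE gwE !invrN !mulrN !divff // !scaleN1r.
rewrite (permPl (perm_cat (perm_map _ ht) (perm_cat (perm_map _ hb) (perm_refl _)))).
rewrite /= !guE !gwE gz !divff ?oppr_eq0 // !scale1r !mulNr !scaleNr.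
by apply/permP => P /=; ring.
Qed.

(** Removing the opposite pair provided by [three_collinear_opposite] leaves a
    uniform balanced configuration of five vectors. *)
Lemma balanced_three_and_four u ts (r : seq 'cV[R]_2) : size ts = 3%N -> size r = 4%N ->
  all (fun t => t != 0) ts -> {in r, forall v, det2 u v != 0} -> uniform r ->
  balanced_seq ([seq t *: u | t <- ts] ++ r) ->
  exists (B2 : 5.-tuple 'cV[R]_2) (c : 'cV[R]_2) (lambda : R),
    [/\ regular_polygon B2, c \in B2, lambda != 0 &
      GL2_equiv ([seq t *: u | t <- ts] ++ r) ([:: lambda *: c; - (lambda *: c)] ++ B2)].
Proof.
move=> szt szr ts0 r0 ur bs.
have [c [t ht]] := three_collinear_opposite szt szr ts0 r0 bs.
have [c0 t0] : c != 0 /\ t != 0.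
  by have := ts0; rewrite (perm_all _ ht) /= => /and3P[].
pose q := c *: u :: r.
have hs : perm_eq ([seq t *: u | t <- ts] ++ r) [:: t *: u, - (t *: u) & q].
  rewrite (permPl (perm_cat (perm_map _ ht) (perm_refl _))) /= scaleNr.
  by apply/permP => P /=; ring.
have bq : balanced_seq q.
  move=> v vq; have vs : v \in [:: t *: u, - (t *: u) & q] by rewrite 2!in_cons vq !orbT.
  by have := perm_balanced_seq hs bs vs; rewrite /= det2Nr symm_pair.
have uq : uniform q.
  move=> v; rewrite inE => /predU1P[->|vr] /=.
    rewrite det2vv eqxx (eq_in_count (a2 := pred0)) ?count_pred0 // => w wr /=.
    by rewrite det2Zl mulf_eq0 (negbTE c0) (negbTE (r0 w wr)).
  rewrite det2Zr mulf_eq0 (negbTE c0) det2_eq0_sym (negbTE (r0 v vr)) add0n.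
  exact: ur.
have szq : size q = 5%N by rewrite /= szr.
have := @uniform_balanced_regular R q; rewrite szq => -[] // P regP [g gu gP].
exists P, (g *m (c *: u)), (t / c); split=> //.
- by rewrite -(perm_mem gP) map_f ?mem_head.
- by rewrite mulf_neq0 ?invr_eq0.
have gE : g *m (t *: u) = (t / c) *: (g *m (c *: u)).
  by rewrite -!scalemxAr scalerA divfK.
by exists g => //; rewrite (permPl (perm_map _ hs)) /= mulmxN gE !perm_cons.
Qed.

End Classification.

Theorem corollary2p9 (R : realType) (B : 7.-tuple 'cV[R]_2)
    (B_neq0 : forall i : 'I_7, tnth B i != 0) (B_balanced : balanced B) :
  (exists2 P : 7.-tuple 'cV[R]_2, regular_polygon P & GL2_equiv B P)
  \/ (exists (B2 : 5.-tuple 'cV[R]_2) (c : 'cV[R]_2) (lambda : R),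
        [/\ regular_polygon B2, c \in B2, lambda != 0 &
            GL2_equiv B ([:: lambda *: c; - (lambda *: c)] ++ B2)])
  \/ (exists lambda mu : R,
        [/\ lambda != 0, mu != 0 &
            GL2_equiv B [:: e1 R; e2 R; - e1 R - e2 R;
                            lambda *: e1 R; - (lambda *: e1 R);
                            mu *: e2 R; - (mu *: e2 R)]])
  \/ (exists lambda mu : R,
        [/\ lambda != 0, mu != 0 &
            GL2_equiv B [:: e1 R; e2 R; - e1 R - e2 R;
                            lambda *: e1 R; - (lambda *: e1 R);
                            mu *: e1 R; - (mu *: e1 R)]])
  \/ (exists2 C : 7.-tuple 'cV[R]_2, on_line_through_0 C & GL2_equiv B C).
Proof.
have bB := balanced_seq_of_balanced B_balanced; pose s : seq 'cV[R]_2 := B.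
have sz : size s = 7%N by rewrite size_tuple.
have odd_s : odd (size s) by rewrite sz.
have s0 : {in s, forall v, v != 0} by move=> v /tnthP[i ->].
pose par u := fun v : 'cV[R]_2 => det2 u v == 0.
have odd_par u : u \in s -> odd (count (par u) s) by exact: odd_line.
have [/hasP[u us par_u]|unif] := boolP (has (fun u => 1 < count (par u) s)%N s); last first.
  left; have := @uniform_balanced_regular R s; rewrite sz; apply=> //.
  by move=> u us; rewrite leqNgt; apply: contraNN unif => h; apply/hasP; exists u.
right; have u0 := s0 u us; have [ts [ts0 szt hs]] := split_line u0 s0.
pose r := [seq v <- s | det2 u v != 0]; rewrite -/r in hs.
have r0 : {in r, forall v, det2 u v != 0} by move=> v; rewrite mem_filter => /andP[].
have bs := perm_balanced_seq hs bB.
have szr : (size ts + size r = 7%N)%N by rewrite -sz (perm_size hs) size_cat size_map.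
have odd_ts : odd (size ts) by rewrite szt; exact: odd_par.
have ts_gt1 : (1 < size ts)%N by rewrite szt.
have : [|| size ts == 3%N, size ts == 5%N | size ts == 7%N].
  by move: (size ts) odd_ts ts_gt1 szr => [|[|[|[|[|[|[|[|k]]]]]]]] //= _ _; lia.
case/or3P => /eqP sz_ts; rewrite sz_ts in szr.
- have {}szr : size r = 4%N by lia.
  have par_r w : w \in r -> count (par w) s = count (par w) r.
    move=> wr; rewrite (permP hs) count_cat (eq_in_count (a2 := pred0)).
      by rewrite count_pred0.
    move=> _ /mapP[t tts ->]; rewrite /par det2Zr mulf_eq0.
    by rewrite (negbTE (allP ts0 t tts)) det2_eq0_sym (negbTE (r0 w wr)).
  have [/hasP[w wr par_w]|unif] := boolP (has (fun w => 1 < count (par w) r)%N r); last first.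
    left; have [|P [c [l [regP cP l0 eqv]]]] := balanced_three_and_four sz_ts szr ts0 r0 _ bs.
      by move=> w wr; rewrite leqNgt; apply: contraNN unif => h; apply/hasP; exists w.
    by exists P, c, l; split=> //; apply: GL2_equiv_perm eqv.
  right; left; have ws : w \in s by move: wr; rewrite mem_filter => /andP[].
  have w0 := s0 w ws.
  have [|bs' [bs0 szb hr]] := @split_line _ r w w0.
    by move=> v; rewrite mem_filter => /andP[_ /s0].
  pose r' := [seq v <- r | det2 w v != 0]; rewrite -/r' in hr.
  have szr' : (size bs' + size r' = 4%N)%N by rewrite -szr (perm_size hr) size_cat size_map.
  have sz_b : size bs' = 3%N.
    have := odd_par w ws; rewrite par_r // -szb.
    move: par_w; rewrite -szb.
    by move: (size bs') szr' => [|[|[|[|[|k]]]]] //= ; lia.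
  have : size r' = 1%N by apply/eqP; rewrite -(eqn_add2l 3) -{1}sz_b szr'.
  case Er: r' => [//|z []] // _; rewrite Er in hr.
  have : z \in r' by rewrite Er mem_head.
  rewrite mem_filter => /andP[wz zr].
  have hs' : perm_eq s ([seq t *: u | t <- ts] ++ [seq t *: w | t <- bs'] ++ [:: z]).
    by rewrite (permPl hs) perm_cat2l.
  have [l [mu [l0 mu0 eqv]]] :=
    balanced_three_three_one sz_ts sz_b ts0 bs0 (r0 w wr) (r0 z zr) wz (perm_balanced_seq hs' bB).
  by exists l, mu; split=> //; apply: GL2_equiv_perm eqv.
- have : size r = 2%N by lia.
  case Er: r => [//|v [//|w []]] // _; rewrite Er in hs bs.
  have uv : det2 u v != 0 by apply: r0; rewrite Er mem_head.
  have [l [mu [l0 mu0 eqv]]] := balanced_five_one_one sz_ts ts0 uv bs.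
  by right; right; left; exists l, mu; split=> //; apply: GL2_equiv_perm eqv.
right; right; right; exists B; last first.
  by exists 1%:M; rewrite ?unitmx1 // (eq_map (g := id)) ?map_id // => v; rewrite mul1mx.
have r_nil : r = [::] by apply/nilP; rewrite /nilp; lia.
exists u => // v vs; apply/parallelP => //; apply: contraTT isT => uv.
by have : v \in r by [rewrite mem_filter uv]; rewrite r_nil.
Qed.
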